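(* Let $\mathcal{H}$ be a separable Hilbert space and let $\xi=\{\xi_n\}_{n\in\mathbb{N}}$ be a lower semi-frame of $\mathcal{H}$ with analysis operator $C_\xi$ and generalized frame operator $T_\xi$. Let $\mathcal{H}_\xi=\overline{\mathcal{D}(C_\xi)}$ and let $P$ be the orthogonal projection of $\mathcal{H}$ onto $\mathcal{H}_\xi$. Let $Y:\ell^2(\mathbb{N})\to\mathcal{H}_\xi$ be the bounded operator which equals $C_\xi^{-1}$ on the range $R(C_\xi)$ and $0$ on $R(C_\xi)^\perp$, and let $\eta_n:=Ye_n$ for $n\in\mathbb{N}$, where $\{e_n\}_{n\in\mathbb{N}}$ is the canonical orthonormal basis of $\ell^2(\mathbb{N})$. Then $\eta_n=T_\xi^{-1}P\xi_n$ for every $n\in\mathbb{N}$.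
   Context: Inner products $\langle\cdot,\cdot\rangle$ are linear in the first variable. A sequence $\xi=\{\xi_n\}_{n\in\mathbb{N}}$ in $\mathcal{H}$ is a lower semi-frame of $\mathcal{H}$ if there is $A>0$ with $A\|f\|^2\le\sum_{n}|\langle f,\xi_n\rangle|^2$ for all $f\in\mathcal{H}$ (the sum may be $+\infty$). The analysis operator $C_\xi$ has domain $\mathcal{D}(C_\xi)=\{f\in\mathcal{H}:\sum_n|\langle f,\xi_n\rangle|^2<\infty\}$ (not assumed dense) and $C_\xi f=\{\langle f,\xi_n\rangle\}_n\in\ell^2(\mathbb{N})$. It is closed; if $\xi$ is a lower semi-frame then $C_\xi$ is injective, $R(C_\xi)$ is closed and $C_\xi^{-1}:R(C_\xi)\to\mathcal{H}_\xi$ is bounded. Here $\mathcal{H}_\xi=\overline{\mathcal{D}(C_\xi)}$ is a Hilbert space with the inner product of $\mathcal{H}$. The generalized frame operator $T_\xi:\mathcal{D}(T_\xi)\subseteq\mathcal{H}_\xi\to\mathcal{H}_\xi$ is defined as follows: $\mathcal{D}(T_\xi)$ is the set of $f\in\mathcal{D}(C_\xi)$ for which there is $h\in\mathcal{H}_\xi$ with $\sum_n\langle f,\xi_n\rangle\langle\xi_n,g\rangle=\langle h,g\rangle$ for all $g\in\mathcal{D}(C_\xi)$, and then $T_\xi f=h$ (unique). When $\xi$ is a lower semi-frame, $T_\xi:\mathcal{D}(T_\xi)\to\mathcal{H}_\xi$ is bijective with bounded inverse. *)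

(* Defs.v *)
From HB Require Import structures.
From mathcomp Require Import all_boot all_order all_algebra.
From mathcomp Require Export sesquilinear complex.
From mathcomp Require Import ring.
From mathcomp Require Import all_classical all_reals all_analysis.

Set Implicit Arguments.
Unset Strict Implicit.
Unset Printing Implicit Defensive.

Import Order.TTheory GRing.Theory Num.Theory.
Import numFieldNormedType.Exports.

Local Open Scope classical_set_scope.
Local Open Scope ring_scope.
Local Open Scope complex_scope.

Definition separable_space (T : topologicalType) : Prop :=
  exists2 D : set T, countable D & dense D.

(* In a normed space over R[i] the norm `|x| lives in R[i]; [rnorm] is the same
   number seen in R. *)
Definition rnorm (R : realType) (V : normedZmodType R[i]) (x : V) : R :=
  complex.Re `|x|.

Section l2.
Variable R : realType.
Implicit Types c d : nat -> R[i].

Definition sqsum c : \bar R := (\sum_(0 <= n <oo) (rnorm (c n) ^+ 2)%:E)%E.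

Definition square_summable : {pred nat -> R[i]} :=
  fun c => (sqsum c < +oo)%E.

Lemma rnorm_ge0 (z : R[i]) : 0 <= rnorm z.
Proof. by have := normr_ge0 z; rewrite lecE /= => /andP[]. Qed.

Lemma rnormE (z : R[i]) : `|z| = (rnorm z)%:C.
Proof. by rewrite /rnorm normc_def. Qed.

Lemma square_summable_submod_closed : submod_closed square_summable.
Proof.
have sq0 (z : R[i]) : (0%E <= (rnorm z ^+ 2)%:E)%E.
  by rewrite lee_fin sqr_ge0.
split.
  rewrite unfold_in /square_summable /sqsum eseries0 ?ltry// => n _ _.
  have -> : (0 : nat -> R[i]) n = 0 by [].
  by rewrite /rnorm normr0 expr0n.
move=> a c d; rewrite !unfold_in /square_summable => cfin dfin.
pose ka := 2 * rnorm a ^+ 2.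
have ka0 : 0 <= ka by rewrite mulr_ge0// sqr_ge0.
apply: (@le_lt_trans _ _ (ka%:E * sqsum c + 2%:E * sqsum d)%E).
  rewrite /sqsum -!nneseriesZl//; try by move=> *; exact: sq0.
  rewrite -nneseriesD//; first last.
  - by move=> n _ _; rewrite mule_ge0.
  - by move=> n _ _; rewrite mule_ge0.
  apply: lee_nneseries => [n _ _|n _]; first exact: sq0.
  rewrite -!EFinM -EFinD lee_fin.
  have le1 : rnorm ((a *: c + d) n) <= rnorm a * rnorm (c n) + rnorm (d n).
    rewrite -lecR rmorphD rmorphM /= -!rnormE -normrM.
    exact: ler_normD.
  have h1 : rnorm ((a *: c + d) n) ^+ 2
      <= (rnorm a * rnorm (c n) + rnorm (d n)) ^+ 2.
    rewrite ler_sqr// nnegrE ?rnorm_ge0//.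
    by rewrite addr_ge0 ?mulr_ge0 ?rnorm_ge0.
  apply: (le_trans h1); rewrite /ka -subr_ge0.
  set x := rnorm a; set y := rnorm (c n); set z := rnorm (d n).
  rewrite (_ : _ - _ = (x * y - z) ^+ 2) ?sqr_ge0//.
  by rewrite sqrrB sqrrD exprMn -!mulrA; ring.
have sqsum_ge0 e : (0 <= sqsum e)%E by apply: nneseries_ge0 => *; exact: sq0.
apply: lte_add_pinfty; apply: lte_mul_pinfty => //=; rewrite ?lee_fin//.
Qed.

HB.instance Definition _ := GRing.isSubmodClosed.Build R[i] (nat -> R[i])
  square_summable square_summable_submod_closed.

Record l2 := L2 { l2val :> nat -> R[i]; _ : l2val \in square_summable }.

HB.instance Definition _ := [isSub for l2val].
HB.instance Definition _ := [Choice of l2 by <:].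
HB.instance Definition _ := [SubChoice_isSubLmodule of l2 by <:].

Definition l2norm (c : l2) : R := Num.sqrt (fine (sqsum c)).

Definition l2dot (c d : l2) : R[i]^o :=
  limn (series (fun n => (c n * (d n)^*) : R[i]^o)).

Definition l2ortho (M : set l2) : set l2 :=
  [set c : l2 | forall d : l2, M d -> l2dot c d = 0].

Fact l2basis_subproof (n : nat) :
  (fun k => (k == n)%:R : R[i]) \in square_summable.
Proof.
rewrite unfold_in /square_summable /sqsum (nneseries_split 0 n.+1); last first.
  by move=> k _; rewrite lee_fin sqr_ge0.
rewrite add0n [X in (_ + X)%E]eseries0 ?adde0; last first.
  move=> k /= nk _; rewrite gtn_eqF//.
  by rewrite /rnorm normr0 expr0n.
by rewrite sumEFin ltry.
Qed.

Definition l2basis (n : nat) : l2 := L2 (l2basis_subproof n).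

End l2.

Section semiframe.
Variables (R : realType) (H : normedModType R[i]) (dot : {dot H for Num.conj}).
Implicit Types (xi : nat -> H) (f g h : H) (M : set H) (P : H -> H).

Definition orthogonal_projection M P : Prop :=
  forall f, M (P f) /\ forall g, M g -> dot (f - P f) g = 0.

Definition lower_semiframe xi : Prop :=
  exists2 A : R, 0 < A &
    forall f, ((A * rnorm f ^+ 2)%:E <= sqsum (fun n => dot f (xi n)))%E.

(* Operators with a domain are total functions paired with their domain; the
   values outside of the domain are irrelevant. *)
Definition analysis_dom xi : set H :=
  [set f | (fun n => dot f (xi n)) \in @square_summable R].

Definition analysis_op xi f : l2 R := insubd 0 (fun n => dot f (xi n)).

Definition analysis_range xi : set (l2 R) := analysis_op xi @` analysis_dom xi.

Definition analysis_inv xi : l2 R -> H :=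
  'pinv_(fun=> 0) (analysis_dom xi) (analysis_op xi).

Definition Hspace xi : set H := closure (analysis_dom xi).

Definition gframe_graph xi f h : Prop :=
  [/\ analysis_dom xi f, Hspace xi h & forall g, analysis_dom xi g ->
    series (fun n => (dot f (xi n) * dot (xi n) g) : R[i]^o) @ \oo
      --> (dot h g : R[i]^o)].

Definition gframe_dom xi : set H := [set f | exists h, gframe_graph xi f h].

Definition gframe_op xi f : H := xget 0 [set h | gframe_graph xi f h].

Definition gframe_range xi : set H := gframe_op xi @` gframe_dom xi.

Definition gframe_inv xi : H -> H :=
  'pinv_(fun=> 0) (gframe_dom xi) (gframe_op xi).

End semiframe.

(* Main.v *)
Require Import Defs.
From HB Require Import structures.
From mathcomp Require Import all_boot all_order all_algebra.
From mathcomp Require Import sesquilinear complex.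
From mathcomp Require Import ring lra.
From mathcomp Require Import all_classical all_reals all_analysis.

Import Order.TTheory GRing.Theory Num.Theory.
Import numFieldNormedType.Exports.

Local Open Scope classical_set_scope.
Local Open Scope ring_scope.
Local Open Scope complex_scope.

(** The element of [R(C_xi)] closest to [e_n] is [C_xi f] for some [f] in
    [D(C_xi)]: along a minimising sequence the parallelogram law makes the
    coefficient sequences Cauchy, the lower semi-frame bound makes the vectors
    themselves Cauchy in [H], and Fatou's lemma shows that the limit is still in
    the domain and minimal.  Hence [C_xi f - e_n] is orthogonal to [R(C_xi)], so
    that [Y e_n = Y (C_xi f) = f], and for [g] in [D(C_xi)] one gets
    [<C_xi f, C_xi g> = <e_n, C_xi g> = <xi_n, g> = <P xi_n, g>], that is
    [T_xi f = P xi_n]. *)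

(** * Real-valued norms and convergence over the complex field *)

Section rnorm.
Variables (R : realType) (V : normedModType R[i]).

Lemma normr_rnorm (x : V) : `|x| = (rnorm x)%:C.
Proof.
have := normr_ge0 x; rewrite lecE /rnorm /= => /andP[/eqP Im0 _].
by rewrite [LHS]complexE Im0 mulr0 addr0.
Qed.

Lemma rnormr_ge0 (x : V) : 0 <= rnorm x.
Proof. by have := normr_ge0 x; rewrite normr_rnorm lecE => /andP[]. Qed.

Lemma rnorm_eq0 (x : V) : rnorm x = 0 -> x = 0.
Proof. by move=> x0; apply/eqP; rewrite -normr_eq0 normr_rnorm x0. Qed.

(** A positive radius in [R[i]] has zero imaginary part, so only real radii matter. This moves
    limits to [R], where squeezing applies. *)
Lemma cvg_rnormP (u : nat -> V) (l : V) :
  u @ \oo --> l <-> rnorm (l - u n) @[n --> \oo] --> (0 : R).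
Proof.
split=> [/cvgrPdist_lt ul|/cvgrPdist_lt ul].
  apply/cvgrPdist_lt => e e0; have := ul e%:C; rewrite ltcR => /(_ e0).
  apply: filterS => n; rewrite normr_rnorm ltcR sub0r normrN.
  by rewrite ger0_norm ?rnormr_ge0.
apply/cvgrPdist_lt => e; rewrite ltcE /= => /andP[/eqP Im0 e0].
have := ul _ e0; apply: filterS => n.
rewrite sub0r normrN ger0_norm ?rnormr_ge0// => le.
by rewrite normr_rnorm ltcE /= Im0 eqxx.
Qed.

End rnorm.

Section complex_facts.
Variable R : realType.
Implicit Types (z : R[i]).

Lemma sqr_rnorm z : rnorm z ^+ 2 = complex.Re z ^+ 2 + complex.Im z ^+ 2.
Proof. by rewrite /rnorm normc_def /= sqr_sqrtr// addr_ge0// sqr_ge0. Qed.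

Lemma rnorm_le z : rnorm z <= `|complex.Re z| + `|complex.Im z|.
Proof.
rewrite -(@ler_pXn2r _ 2)// ?nnegrE ?rnorm_ge0 ?addr_ge0//.
rewrite sqr_rnorm sqrrD !real_normK ?num_real// lerD2r lerDl.
by rewrite mulrn_wge0// mulr_ge0.
Qed.

Lemma cvgr_unique (u : nat -> R) (x y : R) :
  u @ \oo --> x -> u @ \oo --> y -> x = y.
Proof. by move=> ux uy; rewrite -(cvg_lim _ ux)// (cvg_lim _ uy). Qed.

Lemma cvg_complex0 (u : nat -> R[i]^o) :
  complex.Re (u n) @[n --> \oo] --> (0 : R) ->
  complex.Im (u n) @[n --> \oo] --> (0 : R) -> u @ \oo --> (0 : R[i]^o).
Proof.
move=> /(norm_cvg0P (fun n => complex.Re (u n))).2 re0.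
move=> /(norm_cvg0P (fun n => complex.Im (u n))).2 im0; apply/cvg_rnormP.
apply: (@squeeze_cvgr _ _ _ _ (cst 0)
  (fun n => `|complex.Re (u n)| + `|complex.Im (u n)|)).
- near=> n; rewrite rnormr_ge0 /= sub0r.
  by rewrite /rnorm normrN; exact: rnorm_le.
- exact: cvg_cst.
- by rewrite -[X in _ --> X]addr0; exact: cvgD.
Unshelve. all: by end_near. Qed.

End complex_facts.

(** * Square sums: the parallelogram law and minimality versus orthogonality *)

Section square_summable_sequences.
Variable R : realType.
Implicit Types (a b c : nat -> R[i]).

Definition sqpsum c (K : nat) : R := \sum_(0 <= k < K) rnorm (c k) ^+ 2.

(** The terms are nonnegative, so the partial sums increase to the sum. Finite partial sums are what
    survives a termwise limit in the Fatou argument. *)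
Lemma sqsum_leP c (m : R) :
  (sqsum c <= m%:E)%E <-> forall K, sqpsum c K <= m.
Proof.
have c0 n : (0%N <= n)%N -> true -> (0%E <= (rnorm (c n) ^+ 2)%:E)%E.
  by rewrite lee_fin sqr_ge0.
split=> [cm K|cm].
  rewrite -lee_fin; apply: le_trans cm; rewrite /sqpsum -sumEFin.
  exact: nneseries_lim_ge.
apply: lime_le; first exact: is_cvg_nneseries.
by near=> K; rewrite sumEFin lee_fin; exact: cm.
Unshelve. all: by end_near. Qed.

Lemma sqsum_ge0 c : (0 <= sqsum c)%E.
Proof. by apply: nneseries_ge0 => n _ _; rewrite lee_fin sqr_ge0. Qed.

Lemma fine_sqsumK c : c \in @square_summable R -> (fine (sqsum c))%:E = sqsum c.
Proof. by move=> cs; rewrite fineK// ge0_fin_numE ?sqsum_ge0. Qed.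

Lemma sqpsum_cvg c : c \in @square_summable R ->
  sqpsum c @ \oo --> fine (sqsum c).
Proof.
move=> cs; suff : (sqpsum c n)%:E @[n --> \oo] --> (fine (sqsum c))%:E.
  by move=> /fine_cvg.
rewrite fine_sqsumK//.
under eq_fun do rewrite -sumEFin.
by apply: is_cvg_nneseries => n _ _; rewrite lee_fin sqr_ge0.
Qed.

(** The identity holds term by term, hence for partial sums, and both sides converge. *)
Lemma sqsum_parallelogram a b :
  a \in @square_summable R -> b \in @square_summable R ->
  fine (sqsum (a + b)) + fine (sqsum (a - b)) =
  2 * (fine (sqsum a) + fine (sqsum b)).
Proof.
move=> as_ bs.
have /sqpsum_cvg h1 : a + b \in @square_summable R by rewrite rpredD.
have /sqpsum_cvg h2 : a - b \in @square_summable R by rewrite rpredB.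
have sumE : (fun K => sqpsum (a + b) K + sqpsum (a - b) K) =
            fun K => 2 * (sqpsum a K + sqpsum b K).
  apply/funext => K; rewrite /sqpsum /= -!big_split /= mulr_sumr.
  apply: eq_bigr => k _; rewrite !sqr_rnorm.
  rewrite (_ : (a + b) k = a k + b k)// (_ : (a - b) k = a k - b k)//.
  by case: (a k) (b k) => [x y] [z t] /=; ring.
apply: (@cvgr_unique _ (fun K => 2 * (sqpsum a K + sqpsum b K))).
  by rewrite -sumE; exact: cvgD.
by apply: cvgMr; apply: cvgD; exact: sqpsum_cvg.
Qed.

(* [2 <a, t b> = |a + t b|^2 - |a|^2 - t^2 |b|^2] shows that the real part of the
   pairing converges; minimality of [|a + t b|^2] at [t = 0] kills its limit. *)
Lemma closest_Re_cvg0 a b :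
  a \in @square_summable R -> b \in @square_summable R ->
  (forall t : R, fine (sqsum a) <= fine (sqsum (a + t%:C *: b))) ->
  \sum_(0 <= k < n) complex.Re (a k * (b k)^*) @[n --> \oo] --> (0 : R).
Proof.
move=> as_ bs amin; pose S n := \sum_(0 <= k < n) complex.Re (a k * (b k)^*).
have sqE t n : sqpsum (a + t%:C *: b) n =
    sqpsum a n + 2 * t * S n + t ^+ 2 * sqpsum b n.
  rewrite /sqpsum /S !mulr_sumr -!big_split /=; apply: eq_bigr => k _.
  rewrite !sqr_rnorm (_ : (a + _) k = a k + t%:C * b k)//.
  by case: (a k) (b k) => [x y] [z u] /=; ring.
have abs_ t : a + t%:C *: b \in @square_summable R by rewrite rpredD ?rpredZ.
(* The expansion at [t = 1] writes [S] through three convergent sequences. *)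
have [L SL] : exists L, S @ \oo --> (L : R).
  exists (2^-1 * (fine (sqsum (a + 1%:C *: b)) -
                  fine (sqsum a) - fine (sqsum b))).
  have -> : S = fun n => 2^-1 * (sqpsum (a + 1%:C *: b) n - sqpsum a n
                                 - sqpsum b n).
    by apply/funext => n; rewrite sqE; field.
  by apply: cvgMr; apply: cvgB; [apply: cvgB|]; exact: sqpsum_cvg.
suff L0 : L = 0 by rewrite L0 in SL; exact: SL.
have sqsumE t : fine (sqsum (a + t%:C *: b)) =
    fine (sqsum a) + 2 * t * L + t ^+ 2 * fine (sqsum b).
  apply: (@cvgr_unique _ _ _ _ (sqpsum_cvg _ (abs_ t))).
  have -> : sqpsum (a + t%:C *: b) =
      fun n => sqpsum a n + 2 * t * S n + t ^+ 2 * sqpsum b n.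
    by apply/funext => n; exact: sqE.
  apply: cvgD; last by apply: cvgMr; exact: sqpsum_cvg.
  by apply: cvgD; [exact: sqpsum_cvg|exact: cvgMr].
set N := fine (sqsum b).
have N0 : 0 <= N by rewrite /N fine_ge0// sqsum_ge0.
(* The minimiser of the quadratic would be [- L / N]; [N + 1] avoids the case [N = 0] and still
   gives the increment [- L ^+ 2 * (N + 2) / (N + 1) ^+ 2], which must be nonnegative. *)
have := amin (- L / (N + 1)); rewrite sqsumE -/N -subr_ge0.
have -> : fine (sqsum a) + 2 * (- L / (N + 1)) * L + (- L / (N + 1)) ^+ 2 * N
    - fine (sqsum a) = - (L ^+ 2 * ((N + 2) / (N + 1) ^+ 2)).
  by field; apply/eqP; lra.
rewrite oppr_ge0 pmulr_lle0; last by rewrite divr_gt0 ?exprn_gt0//; lra.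
by move=> L0; apply/eqP; rewrite -sqrf_eq0 eq_le L0 sqr_ge0.
Qed.

(** The imaginary part of the pairing with [b] is the real part of the pairing with ['i *: b], and
    complex [t] make [a] minimal in both directions. *)
Lemma closest_pairing_cvg0 a b :
  a \in @square_summable R -> b \in @square_summable R ->
  (forall t : R[i], fine (sqsum a) <= fine (sqsum (a + t *: b))) ->
  series (fun k => a k * (b k)^* : R[i]^o) @ \oo --> (0 : R[i]^o).
Proof.
move=> as_ bs amin.
have reE n : complex.Re (series (fun k => a k * (b k)^* : R[i]^o) n) =
    \sum_(0 <= k < n) complex.Re (a k * (b k)^*).
  by rewrite /series /= raddf_sum.
have imE n : complex.Im (series (fun k => a k * (b k)^* : R[i]^o) n) =
    \sum_(0 <= k < n) complex.Re (a k * (('i%C *: b) k)^*).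
  rewrite /series /= raddf_sum; apply: eq_bigr => k _.
  rewrite (_ : ('i%C *: b) k = 'i%C * b k)//.
  by case: (a k) (b k) => [x y] [z u] /=; ring.
apply: cvg_complex0; [under eq_fun do rewrite reE|under eq_fun do rewrite imE].
- by apply: closest_Re_cvg0.
- by apply: closest_Re_cvg0 => // [|t]; rewrite ?rpredZ// scalerA; exact: amin.
Qed.

End square_summable_sequences.

Arguments sqpsum {R} c K.

Section rnorm_continuity.
Variables (R : realType) (V : normedModType R[i]).

Lemma ler_rnormD (x y : V) : rnorm (x + y) <= rnorm x + rnorm y.
Proof.
by have := ler_normD x y; rewrite !normr_rnorm -rmorphD lecR.
Qed.

Lemma rnormN (x : V) : rnorm (- x) = rnorm x.
Proof. by rewrite /rnorm normrN. Qed.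

Lemma cvg_rnorm (u : nat -> V) (l : V) : u @ \oo --> l ->
  rnorm (u n) @[n --> \oo] --> (rnorm l : R).
Proof.
move=> /cvg_rnormP ul; apply/cvgrPdist_le => e e0.
move/cvgrPdist_le: ul => /(_ _ e0); apply: filterS => n.
rewrite sub0r normrN ger0_norm ?rnormr_ge0//; apply: le_trans.
rewrite ler_norml; apply/andP; split.
  rewrite lerBrDl lerBlDl -(rnormN (l - _)) opprB.
  by rewrite -{1}(subrK l (u n)) ler_rnormD.
by rewrite lerBlDl -{1}(subrK (u n) l) addrC ler_rnormD.
Qed.

End rnorm_continuity.

(** * Cauchy-Schwarz and continuity of the inner product *)

Section inner_product.
Variables (R : realType) (H : normedModType R[i]) (dot : {dot H for Num.conj}).
Hypothesis norm_dot : forall f : H, `|f| ^+ 2 = dot f f.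
Implicit Types f g h : H.

Lemma dotC f g : dot f g = (dot g f)^*.
Proof. by rewrite (hermC dot) expr0 mul1r. Qed.

Lemma dotBl f g h : dot (f - g) h = dot f h - dot g h.
Proof. by rewrite linearBl. Qed.

Lemma dotBr f g h : dot f (g - h) = dot f g - dot f h.
Proof. by rewrite linearBr. Qed.

Lemma dot_cauchy_schwarz f g : rnorm (dot f g) <= rnorm f * rnorm g.
Proof.
rewrite -lecR rmorphM /= -!normr_rnorm -rnormE.
rewrite -(@ler_pXn2r _ 2)// ?nnegrE ?mulr_ge0// exprMn !norm_dot.
have [->|g0] := eqVneq g 0; first by rewrite linear0r normr0 expr0n /= mulr_ge0 ?dnorm_ge0.
have gg0 : dot g g != 0 by rewrite dnorm_eq0.
(* [a *: g] is the orthogonal projection of [f] onto the line of [g]; Pythagoras bounds its norm by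
   that of [f]. *)
pose a := dot f g / dot g g; pose f1 := f - a *: g.
have o1 : dot f1 g = 0.
  by rewrite dotBl linearZl_LR /= divfK// subrr.
have fE : f = f1 + a *: g by rewrite subrK.
have -> : dot f f = dot f1 f1 + `|a| ^+ 2 * dot g g.
  rewrite {1 2}fE hnormDd; first by rewrite -(dnormZ dot).
  by rewrite linearZr_LR /= o1 mulr0.
have -> : dot f g = a * dot g g by rewrite divfK.
suff pythagoras (x y z : R[i]) : 0 <= x -> 0 <= y ->
    `|z * y| ^+ 2 <= (x + `|z| ^+ 2 * y) * y.
  by apply: pythagoras; exact: dnorm_ge0.
move=> x0 y0; rewrite normrM exprMn (ger0_norm y0).
have -> : (x + `|z| ^+ 2 * y) * y = x * y + `|z| ^+ 2 * y ^+ 2 by ring.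
by rewrite lerDr mulr_ge0.
Qed.

Lemma cvg_dotl (u : nat -> H) f g : u @ \oo --> f ->
  (dot (u n) g : R[i]^o) @[n --> \oo] --> (dot f g : R[i]^o).
Proof.
move=> /cvg_rnormP uf; apply/cvg_rnormP.
apply: (@squeeze_cvgr _ _ _ _ (cst 0) (fun n => rnorm (f - u n) * rnorm g)).
- near=> n; rewrite rnormr_ge0 /= -dotBl.
  exact: dot_cauchy_schwarz.
- exact: cvg_cst.
- by rewrite -[X in _ --> X](mul0r (rnorm g)); exact: cvgMl.
Unshelve. all: by end_near. Qed.

(** For [g] in [M] close to [x], [dot d x = dot d (x - g)] is small by Cauchy-Schwarz. The [+ 1] in
    the radius covers [d = 0]. *)
Lemma closure_dot0 (M : set H) d x :
  (forall g, M g -> dot d g = 0) -> closure M x -> dot d x = 0.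
Proof.
move=> dM Mx; apply: (@rnorm_eq0 _ R[i]^o).
apply/eqP; rewrite eq_le rnorm_ge0 andbT; apply/ler_addgt0Pl => e e0.
rewrite addr0.
have de0 : 0 < e / (rnorm d + 1).
  by rewrite divr_gt0//; have := rnormr_ge0 _ _ d; lra.
have [|g [Mg]] := Mx (ball x (e / (rnorm d + 1))%:C).
  by apply: nbhsx_ballx; rewrite ltcR.
rewrite -ball_normE /= normr_rnorm ltcR => xg.
have -> : dot d x = dot d (x - g) by rewrite dotBr (dM _ Mg) subr0.
apply: le_trans (dot_cauchy_schwarz _ _) _.
have d1 : 0 < rnorm d + 1 by have := rnormr_ge0 _ _ d; lra.
rewrite ltr_pdivlMr// in xg; apply: le_trans (ltW xg).
by rewrite mulrC ler_wpM2l ?rnormr_ge0// lerDl.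
Qed.

(** [h - h'] is orthogonal to [h] and to [h'] separately, hence to itself; no linear structure on
    [M] enters. *)
Lemma closure_dot_inj (M : set H) h h' : closure M h -> closure M h' ->
  (forall g, M g -> dot h g = dot h' g) -> h = h'.
Proof.
move=> Mh Mh' hh'; apply/eqP; rewrite -subr_eq0 -(dnorm_eq0 dot).
have d0 x : closure M x -> dot (h - h') x = 0.
  by apply: closure_dot0 => g Mg; rewrite dotBl hh'// subrr.
by rewrite dotBr !d0// subrr.
Qed.

End inner_product.

(** * The analysis operator and closest points in its range *)

Section analysis.
Variables (R : realType) (H : completeNormedModType R[i]).
Variable dot : {dot H for Num.conj}.
Hypothesis norm_dot : forall f : H, `|f| ^+ 2 = dot f f.
Variable xi : nat -> H.
Hypothesis xi_lower : lower_semiframe dot xi.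
Implicit Types f g h : H.

(** Unlike [analysis_op], which defaults to 0 off the domain, this is linear on all of [H]. *)
Definition coefs f : nat -> R[i] := fun n => dot f (xi n).

Lemma coefsD f g : coefs (f + g) = coefs f + coefs g.
Proof. by apply/funext => n; rewrite /coefs linearDl. Qed.

Lemma coefsZ (a : R[i]) f : coefs (a *: f) = a *: coefs f.
Proof. by apply/funext => n; rewrite /coefs linearZl_LR. Qed.

Lemma coefsB f g : coefs (f - g) = coefs f - coefs g.
Proof. by apply/funext => n; rewrite /coefs linearBl. Qed.

Lemma analysis_domD f g :
  analysis_dom dot xi f -> analysis_dom dot xi g -> analysis_dom dot xi (f + g).
Proof. by rewrite /analysis_dom /= -!/(coefs _) coefsD => *; rewrite rpredD. Qed.

Lemma analysis_domZ (a : R[i]) f :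
  analysis_dom dot xi f -> analysis_dom dot xi (a *: f).
Proof. by rewrite /analysis_dom /= -!/(coefs _) coefsZ => *; rewrite rpredZ. Qed.

Lemma analysis_domB f g :
  analysis_dom dot xi f -> analysis_dom dot xi g -> analysis_dom dot xi (f - g).
Proof. by rewrite /analysis_dom /= -!/(coefs _) coefsB => *; rewrite rpredB. Qed.

Lemma sqsum_coefs_eq0 f : (sqsum (coefs f) <= 0)%E -> f = 0.
Proof.
move=> f0; have [A A0 /(_ f) lowf] := xi_lower.
have := le_trans lowf f0; rewrite lee_fin pmulr_rle0// => f2.
apply: rnorm_eq0; apply/eqP; rewrite -sqrf_eq0 eq_le f2.
exact: sqr_ge0.
Qed.

Lemma analysis_op_inj : {in analysis_dom dot xi &, injective (analysis_op dot xi)}.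
Proof.
move=> f g; rewrite !inE => Df Dg fg; apply/eqP; rewrite -subr_eq0; apply/eqP.
apply: sqsum_coefs_eq0; rewrite coefsB.
have -> : coefs f = coefs g.
  have := congr1 val fg; rewrite /analysis_op.
  by rewrite !insubdK.
rewrite subrr sqsum_leP => K; rewrite /sqpsum big1// => k _.
by rewrite sqr_rnorm expr0n /= addr0.
Qed.

(** The parallelogram law for [coefs p - e] and [coefs d], with [p] the midpoint and [d] half the
    difference, has [coefs f - e] and [coefs g - e] as sum and difference. Since [p] cannot beat
    [m], at most [del] is left for [d]. *)
Lemma minimizing_sequence_bound (e : nat -> R[i]) (m del : R) (A : R) f g :
  e \in @square_summable R -> analysis_dom dot xi f -> analysis_dom dot xi g ->
  (forall h, analysis_dom dot xi h -> m <= fine (sqsum (coefs h - e))) ->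
  (forall h, ((A * rnorm h ^+ 2)%:E <= sqsum (coefs h))%E) ->
  fine (sqsum (coefs f - e)) <= m + del ->
  fine (sqsum (coefs g - e)) <= m + del ->
  A * rnorm (2^-1 *: (f - g)) ^+ 2 <= del.
Proof.
move=> es Df Dg mmin low fm gm.
pose p : H := 2^-1 *: (f + g); pose d : H := 2^-1 *: (f - g).
have Dp : analysis_dom dot xi p by apply/analysis_domZ/analysis_domD.
have Dd : analysis_dom dot xi d by apply/analysis_domZ/analysis_domB.
have ps : coefs p - e \in @square_summable R by rewrite rpredB.
have pdf : p + d = f.
  rewrite -scalerDr addrACA subrr addr0 -mulr2n -[f *+ 2]scaler_nat.
  by rewrite scalerA mulVf ?scale1r// pnatr_eq0.
have pdg : p - d = g.
  rewrite -scalerBr opprB [f + g]addrC addrACA subrr addr0 -mulr2n.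
  by rewrite -[g *+ 2]scaler_nat scalerA mulVf ?scale1r// pnatr_eq0.
have := sqsum_parallelogram _ _ _ ps Dd; rewrite -/(coefs d).
rewrite addrAC -coefsD pdf addrAC -coefsB pdg => para.
have := mmin _ Dp; have := low d; rewrite -fine_sqsumK// lee_fin -/d; lra.
Qed.

(* The minimising sequence is Cauchy in [H] because of the lower bound, and
   Fatou's lemma transports the bound to its limit. *)
Lemma closest_analysis (e : nat -> R[i]) : e \in @square_summable R ->
  exists2 f, analysis_dom dot xi f & forall g, analysis_dom dot xi g ->
    fine (sqsum (coefs f - e)) <= fine (sqsum (coefs g - e)).
Proof.
move=> es; pose E := [set fine (sqsum (coefs g - e)) | g in analysis_dom dot xi].
have lbE : lbound E 0 by move=> _ [g _ <-]; rewrite fine_ge0// sqsum_ge0.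
have D0 : analysis_dom dot xi 0.
  have -> : (0 : H) = 0 *: 0 by rewrite scale0r.
  rewrite /analysis_dom /= -/(coefs _) coefsZ scale0r.
  exact: (rpred0 (@square_summable R)).
have infE : has_inf E.
  by split; [exists (fine (sqsum (coefs 0 - e))); exists 0|exists 0].
pose m := inf E.
have mmin h : analysis_dom dot xi h -> m <= fine (sqsum (coefs h - e)).
  by move=> Dh; apply: ge_inf; [case: infE|exists h].
have /choice[u uP] : forall k : nat, exists f, analysis_dom dot xi f /\
    fine (sqsum (coefs f - e)) <= m + k.+1%:R^-1.
  move=> k; have [|_ [f Df <-] fm] := @inf_adherent _ E k.+1%:R^-1 _ infE.
    by rewrite invr_gt0.
  by exists f; split=> //; exact: ltW.
have [A A0 low] := xi_lower.
have /cvg_ex[f uf] : cvg (u @ \oo).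
  apply/cauchy_cvgP/cauchy_exP => eps; rewrite ltcE /= => /andP[/eqP Im0 e0].
  set r := complex.Re eps in e0.
  (* The bound controls half the difference of two terms, hence [r / 2]. *)
  have Ar0 : 0 < A * (r / 2) ^+ 2 by rewrite mulr_gt0// exprn_gt0// divr_gt0.
  have [N _ NP] := near_infty_natSinv_lt (PosNum Ar0).
  exists (u N); exists N => // k /= Nk.
  rewrite -ball_normE /= normr_rnorm ltcE /= Im0 eqxx /= -/r.
  have [[DN uN] [Dk uk]] := (uP N, uP k).
  (* The error of [u k] is weakened to that of [u N], so that one [del] serves both. *)
  have ukN : fine (sqsum (coefs (u k) - e)) <= m + N.+1%:R^-1.
    apply: (le_trans uk); rewrite lerD2l lef_pV2 ?posrE//.
    by rewrite ler_nat.
  have := minimizing_sequence_bound _ _ _ A _ _ es DN Dk mmin low uN ukN.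
  move=> /le_lt_trans/(_ (NP N (leqnn N))) /=; rewrite ltr_pM2l//.
  rewrite ltr_pXn2r// ?nnegrE ?rnormr_ge0 ?divr_ge0 ?(ltW e0)//.
  suff -> : rnorm (2^-1 *: (u N - u k)) = rnorm (u N - u k) / 2.
    by rewrite ltr_pM2r.
  rewrite /rnorm normrZ normfV normr_nat.
  rewrite normr_rnorm /rnorm (_ : (2^-1 : R[i]) = (2^-1)%:C).
    by rewrite -rmorphM /= mulrC.
  by rewrite fmorphV /= rmorph_nat.
(* Each partial sum has finitely many terms, each continuous in the vector, so it inherits the bound
   [m + n.+1%:R^-1] in the limit. *)
have fm : (sqsum (coefs f - e)%R <= m%:E)%E.
  apply/sqsum_leP => K.
  have cvgK : sqpsum (coefs (u n) - e) K @[n --> \oo] -->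
              sqpsum (coefs f - e) K.
    elim: K => [|K IHK]; rewrite /sqpsum.
      by rewrite big_nil; under eq_fun do rewrite big_nil; exact: cvg_cst.
    rewrite big_nat_recr//=; under eq_fun do rewrite big_nat_recr//=.
    apply: cvgD => //.
    suff h : rnorm ((coefs (u n) - e) K) @[n --> \oo] -->
             rnorm ((coefs f - e) K).
      by under eq_fun do rewrite expr2; rewrite expr2; exact: cvgM.
    apply: (@cvg_rnorm _ R[i]^o).
    by apply: cvgB; [exact: cvg_dotl|exact: cvg_cst].
  apply: (ler_cvg_to cvgK (_ : m + n.+1%:R^-1 @[n --> \oo] --> m)).
    rewrite -[X in _ --> X]addr0; apply: cvgD; first exact: cvg_cst.
    exact: cvg_harmonic.
  near=> n; have [Dn un] := uP n; apply: le_trans un.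
  have ns : coefs (u n) - e \in @square_summable R by rewrite rpredB.
  apply: (sqsum_leP _ (coefs (u n) - e) _).1.
  by rewrite fine_sqsumK.
have fes : coefs f - e \in @square_summable R.
  by rewrite unfold_in /square_summable (le_lt_trans fm)// ltry.
exists f => [|g /mmin mg].
  rewrite /analysis_dom /= -/(coefs f) -[coefs f](subrK e).
  by rewrite rpredD.
by apply: le_trans mg; rewrite -lee_fin fine_sqsumK.
Unshelve. all: by end_near. Qed.

(** Moving [f] to [f + t *: g] stays in the domain, so [coefs f - e] is minimal along every
    direction [coefs g]. *)
Lemma closest_analysis_orthogonal (e : nat -> R[i]) :
  e \in @square_summable R ->
  exists2 f, analysis_dom dot xi f & forall g, analysis_dom dot xi g ->
    series (fun k => (coefs f - e) k * (coefs g k)^* : R[i]^o) @ \oo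
      --> (0 : R[i]^o).
Proof.
move=> es; have [f Df fmin] := closest_analysis _ es.
exists f => // g Dg; apply: closest_pairing_cvg0 => // [|t].
  by rewrite rpredB.
rewrite addrAC -coefsZ -coefsD; apply: fmin.
by apply: analysis_domD => //; exact: analysis_domZ.
Qed.

(** * The generalized frame operator is single-valued and injective *)

Lemma gframe_graph_fun f h h' :
  gframe_graph dot xi f h -> gframe_graph dot xi f h' -> h = h'.
Proof.
move=> [Df Hh fh] [_ Hh' fh'].
apply: (closure_dot_inj _ _ _ norm_dot _ _ _ Hh Hh') => g Dg.
by rewrite -(cvg_lim _ (fh _ Dg))// (cvg_lim _ (fh' _ Dg)).
Qed.

Lemma gframe_opE f h : gframe_graph dot xi f h -> gframe_op dot xi f = h.
Proof.
move=> fh; apply: xget_subset1 => // h1 h2; exact: gframe_graph_fun.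
Qed.

(** Testing both relations against [g = f - f'] and subtracting gives the square sum of
    [coefs (f - f')] as a limit equal to 0; the lower bound concludes. *)
Lemma gframe_graph_inj f f' h :
  gframe_graph dot xi f h -> gframe_graph dot xi f' h -> f = f'.
Proof.
move=> [Df Hh fh] [Df' _ f'h]; apply/eqP; rewrite -subr_eq0; apply/eqP.
have Dd := analysis_domB _ _ Df Df'.
apply: sqsum_coefs_eq0; rewrite -fine_sqsumK// lee_fin.
have d0 := (cvg_rnormP _ R[i]^o _ _).1 (cvgB (fh _ Dd) (f'h _ Dd)).
rewrite subrr in d0.
suff -> : fine (sqsum (coefs (f - f'))) = 0 by [].
apply: (@cvgr_unique _ _ _ _ (sqpsum_cvg _ _ Dd)).
suff sqE : (fun n => rnorm ((0 : R[i]^o) -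
    (series (fun k => dot f (xi k) * dot (xi k) (f - f') : R[i]^o) n -
     series (fun k => dot f' (xi k) * dot (xi k) (f - f') : R[i]^o) n)))
    = sqpsum (coefs (f - f')).
  by rewrite -sqE; exact: d0.
apply/funext => n; rewrite sub0r rnormN /series /= -sumrB.
have -> : \sum_(0 <= k < n) (dot f (xi k) * dot (xi k) (f - f') -
    dot f' (xi k) * dot (xi k) (f - f')) = (sqpsum (coefs (f - f')) n)%:C.
  rewrite /sqpsum rmorph_sum /=; apply: eq_bigr => k _.
  by rewrite -mulrBl -dotBl [dot (xi k) _]dotC -sqr_normc rnormE rmorphXn.
rewrite /rnorm ger0_norm// lecR.
by apply: sumr_ge0 => k _; exact: sqr_ge0.
Qed.

End analysis.

Theorem proposition4p2 (R : realType)
    (H : completeNormedModType R[i]) (dot : {dot H for Num.conj})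
    (norm_dot : forall f : H, `|f| ^+ 2 = dot f f)
    (sepH : separable_space H)
    (xi : nat -> H) (xi_lower : lower_semiframe dot xi)
    (P : H -> H) (P_proj : orthogonal_projection dot (Hspace dot xi) P)
    (Y : {linear l2 R -> H})
    (Y_bounded : exists M : R, forall c : l2 R, rnorm (Y c) <= M * l2norm c)
    (Y_codom : forall c : l2 R, Hspace dot xi (Y c))
    (Y_range : forall c : l2 R,
       analysis_range dot xi c -> Y c = analysis_inv dot xi c)
    (Y_ortho : forall c : l2 R, l2ortho (analysis_range dot xi) c -> Y c = 0)
    (eta : nat -> H) (eta_def : forall n : nat, eta n = Y (l2basis R n)) :
  forall n : nat,
    gframe_range dot xi (P (xi n)) /\ eta n = gframe_inv dot xi (P (xi n)).
Proof.
move=> n; pose e := l2basis R n.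
have es : (e : nat -> R[i]) \in @square_summable R by case: (e).
have [f Df forth] :=
  closest_analysis_orthogonal _ _ _ norm_dot _ xi_lower _ es.
have opE g : analysis_dom dot xi g ->
    (analysis_op dot xi g : nat -> R[i]) = coefs _ _ dot xi g.
  by move=> Dg; rewrite /analysis_op; exact: (insubdK _ Dg).
have etaE : eta n = f.
  (* The residual is orthogonal to the range, so [Y] kills it and agrees on [e] and on
     [analysis_op dot xi f]. *)
  rewrite eta_def -/e; have : Y (analysis_op dot xi f - e) = 0.
    apply: Y_ortho => _ [g Dg <-]; rewrite /l2dot; apply: cvg_lim => //.
    have := forth g Dg; rewrite -!opE//.
  rewrite linearB /= => /eqP; rewrite subr_eq0 => /eqP <-.
  rewrite Y_range; last by exists f.
  rewrite /analysis_inv pinvKV ?inE//.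
  exact: analysis_op_inj.
have graph_f : gframe_graph dot xi f (P (xi n)).
  have [HP Porth] := P_proj (xi n); split => // g Dg.
  (* [g] lies in [Hspace], so it does not see [xi n - P (xi n)]. *)
  have -> : dot (P (xi n)) g = dot (xi n) g.
    apply/esym/eqP; rewrite -subr_eq0 -dotBl; apply/eqP/Porth.
    exact: subset_closure.
  rewrite -[X in _ --> X]add0r.
  (* The coefficients of [f] split into the residual, whose series tends to 0, and [e]. *)
  have -> : series (fun k => dot f (xi k) * dot (xi k) g : R[i]^o) =
      (fun m => series (fun k => (coefs _ _ dot xi f - (e : nat -> R[i])) k *
         (coefs _ _ dot xi g k)^* : R[i]^o) m +
       series (fun k => (e k) * (coefs _ _ dot xi g k)^* : R[i]^o) m).
    apply/funext => m; rewrite /series /= -big_split /=; apply: eq_bigr => k _.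
    by rewrite -mulrDl subrK [dot (xi k) g]dotC.
  apply: cvgD; first exact: forth.
  (* Once [m] exceeds [n], only the term [k = n] is nonzero, so the partial sum is constantly
     [dot (xi n) g]. *)
  apply: cvg_near_cst; near=> m; rewrite /series /=.
  have nm : (n < m)%N by near: m; exact: nbhs_infty_gt.
  rewrite (bigD1_seq n) ?mem_index_iota ?iota_uniq//= eqxx mul1r.
  rewrite big1 ?addr0 => [|k /negbTE ->]; last by rewrite mul0r.
  by rewrite [RHS]dotC.
split.
  by exists f; [exists (P (xi n))|exact: gframe_opE].
(* With [P (xi n)] written as the image of [f], injectivity on the domain lets the partial inverse
   return [f]. *)
rewrite etaE /gframe_inv -(gframe_opE _ _ _ norm_dot _ _ _ graph_f) pinvKV//.
  move=> f1 f2; rewrite !inE => -[h1 g1] [h2 g2].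
  rewrite (gframe_opE _ _ _ norm_dot _ _ _ g1) (gframe_opE _ _ _ norm_dot _ _ _ g2).
  move=> h12; rewrite -h12 in g2; exact: (gframe_graph_inj _ _ _ _ xi_lower _ _ _ g1).
by rewrite inE; exists (P (xi n)).
Unshelve. all: by end_near. Qed.
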